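(* Let $N\ge2$. If $X$ is a convergent left-monomial $N$-homogeneous presentation of an algebra $A$, and $\preccurlyeq$ is a monomial order on $\mathcal{A}(X_0)$ that is compatible with $X_1$, then the set $\mathrm{Red}_m(X)$ of reduced monomials is a PBW basis for $(A,X_0,\preccurlyeq)$. Conversely, let $A$ be an $N$-homogeneous algebra, let $X$ be a generating set of $A$ that is concentrated in degree $1$, let $\preccurlyeq$ be a monomial order on $\mathcal{A}(X)$, and $\mathcal{B}$ be a PBW basis of $(A,X,\preccurlyeq)$. Define $\widetilde{\mathcal{B}}$ as the $1$-polygraph with set of $0$-cells $X$ and with one $1$-cell $$\alpha_{u,v}:\ uv\ \longrightarrow\ [uv]_{\mathcal{B}}$$ for all $u$ and $v$ in $\mathcal{B}$ such that $uv$ has degree $N$ and $uv\neq[uv]_{\mathcal{B}}$. Then $\widetilde{\mathcal{B}}$ is a convergent left-monomial $N$-homogeneous presentation of $A$, such that $\mathrm{Red}_m(\widetilde{\mathcal{B}})=\mathcal{B}$, and $\preccurlyeq$ is compatible with $\widetilde{\mathcal{B}}_1$.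
   Context: Fix a field $\mathbb{K}$; algebras are unital associative $\mathbb{K}$-algebras; $\mathcal{A}(S)$ is the free algebra on a set $S$, with linear basis the free monoid $S^*$, whose elements are called monomials; $\mathrm{supp}(a)$ is the set of monomials with nonzero coefficient in $a$. A $1$-polygraph $X=\langle X_0\,|\,X_1\rangle$ is a set $X_0$ (of $0$-cells) and a set $X_1$ (of $1$-cells) with two maps $s,t:X_1\to\mathcal{A}(X_0)$; $\alpha:a\to b$ means $s(\alpha)=a$, $t(\alpha)=b$. $X$ is a presentation of $A$ if $A$ is isomorphic to the quotient of $\mathcal{A}(X_0)$ by the two-sided ideal generated by the elements $s(\alpha)-t(\alpha)$. $X$ is $N$-homogeneous if $X_0$ is placed in degree $1$ and every $1$-cell has homogeneous source and target of degree $N$; an algebra is $N$-homogeneous if it admits an $N$-homogeneous presentation (and it is graded accordingly). $X$ is left-monomial if, for each $\alpha\in X_1$, $s(\alpha)$ is a monomial not belonging to $\mathrm{supp}(t(\alpha))$. For left-monomial $X$, a rewriting step replaces $\lambda us(\alpha)v+a$ by $\lambda ut(\alpha)v+a$, for $\alpha\in X_1$, $u,v$ monomials, $\lambda\ne0$ a scalar and $a\in\mathcal{A}(X_0)$ with $us(\alpha)v\notin\mathrm{supp}(a)$; an element is reduced if no rewriting step applies to it, and $\mathrm{Red}_m(X)$ is the set of reduced monomials. $X$ terminates if the smallest transitive relation $\succ_X$ on $X_0^*$, stable by product and with $s(\alpha)\succ_Xv$ for all $\alpha\in X_1$, $v\in\mathrm{supp}(t(\alpha))$, is wellfounded; $X$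 is confluent if any two elements obtained from a common one by finite sequences of rewriting steps can be rewritten, by finite sequences of rewriting steps, into a common element. Convergent means terminating and confluent. A monomial order on $\mathcal{A}(S)$ is a wellfounded total order $\preccurlyeq$ on $S^*$ whose strict part is stable by product. It is compatible with $X_1$ if $s(\alpha)\succ v$ for every $\alpha\in X_1$ and $v\in\mathrm{supp}(t(\alpha))$. For a monomial $u$ and $a\in\mathcal{A}(S)$, $u\succ a$ means $u\succ v$ for every $v\in\mathrm{supp}(a)$, and $u\succcurlyeq a$ means $u=a$ or $u\succ a$. Let $A$ be $N$-homogeneous, $X$ a generating set of $A$ concentrated in degree $1$, and $\preccurlyeq$ a monomial order on $\mathcal{A}(X)$. A Poincaré–Birkhoff–Witt (PBW) basis for $(A,X,\preccurlyeq)$ is a subset $\mathcal{B}$ of $X^*$ such that: (i) $\mathcal{B}$ is a linear basis of $A$ (via $X^*\to A$), with $[u]_{\mathcal{B}}\in\mathcal{A}(X)$ denoting the decomposition of (the image in $A$ of) $u\in X^*$ in the basis $\mathcal{B}$; (ii) for all $u,v\in\mathcal{B}$, $uv\succcurlyeq[uv]_{\mathcal{B}}$; (iii) an element $u$ of $X^*$ belongs to $\mathcal{B}$ if, and only if, for every decomposition $u=vu'w$ in $X^*$ with $u'$ of degree $N$, $u'$ belongs to $\mathcal{B}$. *)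

(* Defs.v *)
From HB Require Import structures.
From Stdlib Require Import Relation_Operators.
From mathcomp Require Import all_boot all_algebra generic_quotient ring_quotient.
From mathcomp Require Import finmap boolp classical_sets monalg.

Set Implicit Arguments.
Unset Strict Implicit.
Unset Printing Implicit Defensive.

Import GRing.Theory.

Local Open Scope ring_scope.
Local Open Scope quotient_scope.

(* The library declares this notation only locally. *)
Notation "u * v" := (mmul u v) : monom_scope.

(* The algebra of the free monoid on [S]; [fdeg] is the length of a word. *)
Notation freealg K S := {malg K[{fmonom S}]}.

Section FreeAlgebra.
Context (K : fieldType) (S : choiceType).

Definition homogeneous (n : nat) (a : freealg K S) : Prop :=
  forall u, u \in msupp a -> fdeg u = n.

Definition supported_on (B : set {fmonom S}) (a : freealg K S) : Prop :=
  forall u, u \in msupp a -> B u.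

Inductive generated_ideal (G : set (freealg K S)) : set (freealg K S) :=
| ideal0 : generated_ideal G 0
| ideal_gen a : G a -> generated_ideal G a
| idealD a b : generated_ideal G a -> generated_ideal G b ->
    generated_ideal G (a + b)
| idealM b a c : generated_ideal G a -> generated_ideal G (b * a * c).

Definition ideal (G : set (freealg K S)) : pred (freealg K S) :=
  fun a => `[< generated_ideal G a >].

Lemma ideal_zmod_closed G : zmod_closed (ideal G).
Proof.
split=> [|a b]; first exact/asboolP/ideal0.
move=> /asboolP Ia /asboolP Ib; apply/asboolP/idealD => //.
by have := idealM (-1) 1 Ib; rewrite mulr1 mulN1r.
Qed.

HB.instance Definition _ G :=
  GRing.isZmodClosed.Build (freealg K S) (ideal G) (ideal_zmod_closed G).

(* Only the additive group structure is registered: the quotient ring may be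
   zero, hence need not be an [algType]. *)
Definition quotient (G : set (freealg K S)) :=
  {ideal_quot GRing.ZmodClosed.clone _ (ideal G) _}.

End FreeAlgebra.

(* The algebra morphism [freealg K S -> A] that extends [g : S -> A]. *)
Section Extension.
Context (K : fieldType) (S : choiceType) (A : algType K) (g : S -> A).

Definition word_eval (u : {fmonom S}) : A := \prod_(x <- u) g x.

Lemma word_eval_mmorphism : mmorphism word_eval.
Proof. by split=> [u v|]; rewrite /word_eval ?fmM ?fm1 (big_cat, big_nil). Qed.

HB.instance Definition _ :=
  isMultiplicative.Build {fmonom S} A word_eval word_eval_mmorphism.

Definition extension : freealg K S -> A := mmap (in_alg A) word_eval.

HB.instance Definition _ := GRing.Additive.on extension.

Lemma extension_monoid_morphism : monoid_morphism extension.
Proof.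
suff [extM ext1] : multiplicative extension by [].
apply: commr_mmap_is_multiplicative => a u v.
by rewrite /GRing.comm /= mulr_algl mulr_algr.
Qed.

HB.instance Definition _ :=
  GRing.isMonoidMorphism.Build (freealg K S) A extension
    extension_monoid_morphism.

Lemma extension_scalable : scalable extension.
Proof. by move=> c a; rewrite /extension mmapZ /= mulr_algl. Qed.

HB.instance Definition _ :=
  GRing.isScalable.Build K (freealg K S) A *:%R extension extension_scalable.

End Extension.

Record polygraph (K : fieldType) := Polygraph {
  cells0 : choiceType;
  cells1 : Type;
  src : cells1 -> freealg K cells0;
  tgt : cells1 -> freealg K cells0 }.

Section Polygraphs.
Context (K : fieldType) (X : polygraph K).

Definition relations : set (freealg K (cells0 X)) :=
  [set r | exists al : cells1 X, r = src al - tgt al].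

(* The composite of [phi] with the projection is the algebra morphism
   [extension g], so [phi] is an isomorphism of algebras from the quotient onto
   [A]; every such isomorphism is of this form for a unique [g]. *)
Definition presents (A : algType K) (g : cells0 X -> A) : Prop :=
  exists phi : quotient relations -> A,
    bijective phi /\ forall a, extension g a = phi (\pi_(quotient relations) a).

Definition homogeneous_polygraph (N : nat) : Prop :=
  forall al : cells1 X, homogeneous N (src al) /\ homogeneous N (tgt al).

Definition left_monomial : Prop :=
  forall al : cells1 X, exists s : {fmonom (cells0 X)},
    src al = << s >> /\ s \notin msupp (tgt al).

Inductive rewriting_step : freealg K (cells0 X) -> freealg K (cells0 X) -> Prop :=
| RewritingStep (al : cells1 X) (s u v : {fmonom (cells0 X)}) (la : K)
    (a : freealg K (cells0 X)) of
    src al = << s >> & la != 0 & (u * s * v)%M \notin msupp a :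
    rewriting_step (la *: << (u * s * v)%M >> + a)
                   (la *: (<< u >> * tgt al * << v >>) + a).

Definition rewrites := clos_refl_trans _ rewriting_step.

Definition reduced (a : freealg K (cells0 X)) : Prop :=
  forall b, ~ rewriting_step a b.

Definition reduced_monomials : set {fmonom (cells0 X)} :=
  [set u | reduced << u >>].

Inductive rewriting_gt : {fmonom (cells0 X)} -> {fmonom (cells0 X)} -> Prop :=
| gt_cell (al : cells1 X) (s v : {fmonom (cells0 X)}) of
    src al = << s >> & v \in msupp (tgt al) : rewriting_gt s v
| gt_mul u v w w' of rewriting_gt u v :
    rewriting_gt (w * u * w')%M (w * v * w')%M
| gt_trans u v w of rewriting_gt u v & rewriting_gt v w : rewriting_gt u w.

Definition terminates : Prop := well_founded (fun v u => rewriting_gt u v).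

Definition confluent : Prop :=
  forall a b c, rewrites a b -> rewrites a c ->
    exists d, rewrites b d /\ rewrites c d.

Definition convergent : Prop := terminates /\ confluent.

End Polygraphs.

Arguments presents {K} X {A} g.
Arguments reduced_monomials {K} X _.

Section MonomialOrder.
Context (S : choiceType) (le : rel {fmonom S}).

Definition strict : rel {fmonom S} := fun u v => (u != v) && le u v.

Definition monomial_order : Prop :=
  [/\ total le, antisymmetric le, transitive le,
      well_founded strict
    & forall u v w w' : {fmonom S},
        strict u v -> strict (w * u * w')%M (w * v * w')%M].

Definition dominates (K : fieldType) (u : {fmonom S}) (a : freealg K S) : Prop :=
  forall v, v \in msupp a -> strict v u.

Definition weakly_dominates (K : fieldType) (u : {fmonom S}) (a : freealg K S) :
  Prop := << u >> = a \/ dominates u a.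

End MonomialOrder.

Definition compatible (K : fieldType) (X : polygraph K)
    (le : rel {fmonom (cells0 X)}) : Prop :=
  forall al : cells1 X, exists s : {fmonom (cells0 X)},
    src al = << s >> /\ dominates le s (tgt al).

Arguments compatible {K} X le.

(* The degree [n] part of an algebra presented, by a homogeneous polygraph with
   generators in degree 1, through [g]. *)
Definition degree_part (K : fieldType) (S : choiceType) (A : algType K)
    (g : S -> A) (n : nat) : set A :=
  [set x | exists a, homogeneous n a /\ extension g a = x].

(* [homogeneous_grading N deg] says that the algebra [A] is [N]-homogeneous and
   that [deg] is the grading that it inherits from an [N]-homogeneous
   presentation. *)
Definition homogeneous_grading (K : fieldType) (A : algType K) (N : nat)
    (deg : nat -> set A) : Prop :=
  exists (Y : polygraph K) (g : cells0 Y -> A),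
    [/\ homogeneous_polygraph Y N, presents Y g & deg = degree_part g].

Section PBW.
Context (K : fieldType) (A : algType K).

(* A subset of [A] is given by an injective map [g : S -> A]. *)
Definition degree1_generating_set (deg : nat -> set A) (S : choiceType)
    (g : S -> A) : Prop :=
  [/\ injective g, forall x, deg 1%N (g x)
    & forall a : A, exists c, extension g c = a].

Context (S : choiceType) (g : S -> A).

Definition linear_basis (B : set {fmonom S}) : Prop :=
  forall a : A, exists! c, supported_on B c /\ extension g c = a.

(* The unique such [c] when [B] is a linear basis; [0] is a dummy default. *)
Definition decomposition (B : set {fmonom S}) (u : {fmonom S}) : freealg K S :=
  xget 0 [set c | supported_on B c /\ extension g c = extension g << u >>].

Definition PBW_basis (N : nat) (le : rel {fmonom S}) (B : set {fmonom S}) :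
  Prop :=
  [/\ linear_basis B,
      forall u v : {fmonom S}, B u -> B v ->
        weakly_dominates le (u * v)%M (decomposition B (u * v)%M)
    & forall u : {fmonom S}, B u <->
        forall v u' w : {fmonom S}, u = (v * u' * w)%M -> fdeg u' = N -> B u'].

Definition PBW_cells (N : nat) (B : set {fmonom S}) : Type :=
  {uv : {fmonom S} * {fmonom S} |
    [/\ B uv.1, B uv.2, fdeg (uv.1 * uv.2)%M = N
      & << (uv.1 * uv.2)%M >> <> decomposition B (uv.1 * uv.2)%M]}.

Definition PBW_polygraph (N : nat) (B : set {fmonom S}) : polygraph K :=
  @Polygraph K S (PBW_cells N B)
    (fun al => << ((sval al).1 * (sval al).2)%M >>)
    (fun al => decomposition B ((sval al).1 * (sval al).2)%M).

End PBW.

(* Main.v *)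
Require Import Defs.
From Stdlib Require Import Relation_Operators.
From mathcomp Require Import all_boot all_algebra generic_quotient ring_quotient.
From mathcomp Require Import finmap boolp classical_sets monalg.

(** Both halves rest on one fact about a left-monomial polygraph with a
    compatible monomial order: every element rewrites to a reduced one
    ([reduced_form]), and rewriting changes an element only by a member of the
    ideal of relations ([rewrites_ideal]).  So the reduced monomials always
    span the presented algebra, and what varies is their linear independence.

    If the polygraph is confluent, the elements that rewrite to 0 are closed
    under addition and contain every multiple of a relation by monomials, hence
    they exhaust the ideal ([reduced_ideal0]); a reduced element of the ideal is
    therefore 0, which makes the reduced monomials a linear basis.  The normal
    form of a monomial is its decomposition in that basis, and the order
    decreases along rewriting, which gives axiom (ii).  Axiom (iii) holds because
    a monomial is reduced exactly when none of its factors is a source, and all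
    sources have degree [N].

    Conversely, given a PBW basis [B], every word of length less than [N] is in
    [B] by (iii), so a word of length [N] outside [B] splits, since [N >= 2],
    into two elements of [B] and is the source of a cell ([PBW_reducible]).
    With (iii) again, the reduced monomials are exactly [B].  Confluence and the
    presentation property follow at once: two reduced elements with the same
    image in the algebra have the same expansion in [B], so they are equal.
    Homogeneity of the cells is where the grading enters: the components of a
    relation that holds in an [N]-homogeneous algebra hold separately
    ([extension_component]).  Applied to the relation between a word of length
    [N] and its decomposition, this kills the components of the decomposition in
    all other degrees. *)

Set Implicit Arguments.
Unset Strict Implicit.
Unset Printing Implicit Defensive.

Import GRing.Theory.

Local Open Scope ring_scope.
Local Open Scope quotient_scope.

Local Notation "u * v" := (mmul u v) : monom_scope.

(** * The free algebra *)

Section FreeAlgebraTheory.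
Context (K : fieldType) (S : choiceType).
Implicit Types (a b c : freealg K S) (u v w : {fmonom S}) (x y : K).

Lemma scaled_monomialE x u : << x *g u >> = x *: << u >> :> freealg K S.
Proof.
apply/malgP => k; rewrite mcoeffZ (mcoeffU u x) (mcoeffU u 1) mulrnAr mulr1.
exact: erefl.
Qed.

Lemma monomialM u v : << (u * v)%M >> = << u >> * << v >> :> freealg K S.
Proof. by rewrite malgM_def fgmulUU mulr1. Qed.

Lemma monomial_inj u v : << u >> = << v >> :> freealg K S -> u = v.
Proof.
move=> /(congr1 (mcoeff u)); rewrite mcoeffUU mcoeffU1.
by case: eqP => // _ /eqP; rewrite oner_eq0.
Qed.

Lemma freealg_expansion a : a = \sum_(u <- msupp a) a@_u *: << u >>.
Proof.
by rewrite {1}[a]monalgE; apply: eq_bigr => u _; rewrite scaled_monomialE.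
Qed.

(** The axioms of a left algebra let a scalar pass through the left factor
    only; here it also passes through the right one because constants
    commute with every monomial. *)
Lemma freealg_scalerAr x a b : x *: (a * b) = a * (x *: b).
Proof.
have central : a * malgC x = malgC x * a.
  rewrite (malgM_def a) fgmulgU (malgM_def _ a) fgmulUg.
  by apply: eq_bigr => u _; rewrite mulm1 mul1m mulrC.
rewrite -(mul_malgC x (a * b)) mulrA -central -mulrA (mul_malgC x b).
exact: erefl.
Qed.

Lemma freealg_ind (P : freealg K S -> Prop) :
    P 0 -> (forall a b, P a -> P b -> P (a + b)) ->
    (forall x u, P (x *: << u >>)) ->
  forall a, P a.
Proof.
move=> P0 PD PU a; rewrite [a]freealg_expansion.
by elim/big_ind: _ => // u _; apply: PU.
Qed.

Definition sandwich u a v : freealg K S := << u >> * a * << v >>.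

(** By bilinearity, a two-sided ideal is additively spanned by the products of
    its generators with scalars and monomials; this is how properties of the
    ideal are reduced to single rewriting steps. *)
Lemma generated_ideal_span (G : set (freealg K S)) (P : freealg K S -> Prop) :
    P 0 -> (forall a b, P a -> P b -> P (a + b)) ->
    (forall x u r v, G r -> P (x *: sandwich u r v)) ->
  forall a, generated_ideal G a -> P a.
Proof.
move=> P0 PD PG a Ia.
(* Strengthened to all multiples of [a], so that products go through. *)
suff /(_ 1 1) : forall b c, P (b * a * c) by rewrite mul1r mulr1.
elim: a / Ia => [|r Gr|a1 a2 _ IH1 _ IH2|b' a c' _ IH] b c.
- by rewrite mulr0 mul0r.
- elim/freealg_ind: b => [|b1 b2 P1 P2|x u]; first by rewrite !mul0r.
    by rewrite !mulrDl; apply: PD.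
  elim/freealg_ind: c => [|c1 c2 P1 P2|y v]; first by rewrite !mulr0.
    by rewrite mulrDr; apply: PD.
  by rewrite -freealg_scalerAr -!scalerAl scalerA; apply: PG.
- by rewrite mulrDr mulrDl; apply: PD.
- by rewrite !mulrA -[b * b' * _ * _ * _]mulrA; apply: IH.
Qed.

Lemma generated_ideal_scale (G : set (freealg K S)) x a :
  generated_ideal G a -> generated_ideal G (x *: a).
Proof. by move=> /(idealM (x *: 1) 1); rewrite mulr1 -scalerAl mul1r. Qed.

Lemma msupp_addP a b u : u \in msupp (a + b) -> u \in msupp a \/ u \in msupp b.
Proof. by move=> /(fsubsetP (msuppD_le _ _)); rewrite in_fsetU => /orP. Qed.

Lemma msupp_scale x a u : u \in msupp (x *: a) -> u \in msupp a.
Proof. exact/fsubsetP/msuppZ_le. Qed.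

Lemma msupp_monomial u v : u \in msupp (<< v >> : freealg K S) -> u = v.
Proof. by rewrite msuppU1 in_fset1 => /eqP. Qed.

Lemma msupp_sandwich u a v w : w \in msupp (sandwich u a v) ->
  exists2 m, m \in msupp a & w = (u * m * v)%M.
Proof.
move=> /msuppM_le [w1 [v' [/msuppM_le [u' [m [u'S mS ->]]] v'S ->]]].
by exists m => //; rewrite (msupp_monomial u'S) (msupp_monomial v'S).
Qed.

Lemma sandwichB u a b v : sandwich u (a - b) v = sandwich u a v - sandwich u b v.
Proof. by rewrite /sandwich mulrBr mulrBl. Qed.

Lemma sandwich_monomial u s v : sandwich u << s >> v = << (u * s * v)%M >>.
Proof. by rewrite /sandwich 2!monomialM. Qed.

End FreeAlgebraTheory.

(** * Linear rewriting *)

(** The rewriting theory needs of the free algebra only its underlying vector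
    space: [V] has basis [mono], with coordinates [coef] and supports [supp].
    A rule [rule p m] turns the basis vector [p] into the vector [m], and [step]
    applies a rule to one basis vector in the support of an element. *)
Section LinearRewriting.
Context (K : fieldType) (T : choiceType) (V : lmodType K).
Context (mono : T -> V) (coef : T -> V -> K) (supp : V -> {fset T}).
Hypothesis coefD : forall p a b, coef p (a + b) = coef p a + coef p b.
Hypothesis coefZ : forall p x a, coef p (x *: a) = x * coef p a.
Hypothesis coef_mono : forall p q, coef q (mono p) = (p == q)%:R.
Hypothesis mem_supp : forall a p, (p \in supp a) = (coef p a != 0).
Hypothesis supp_eq0 : forall a, supp a = fset0 -> a = 0.
Context (rule : T -> V -> Prop) (step : V -> V -> Prop).
Hypothesis stepP : forall a b, step a b <->
  exists p m x c, [/\ rule p m, x != 0, p \notin supp c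
    & a = x *: mono p + c /\ b = x *: m + c].

Implicit Types (a b c d m : V) (p q r : T) (x y : K).

Let reducible p := exists m, rule p m.
Let steps := clos_refl_trans V step.
Let irreducible a := forall b, ~ step a b.

Lemma supp_addP a b p : p \in supp (a + b) -> p \in supp a \/ p \in supp b.
Proof.
rewrite !mem_supp coefD; have [->|] := eqVneq (coef p a) 0; last by left.
by rewrite add0r; right.
Qed.

Lemma supp_scale x a p : p \in supp (x *: a) -> p \in supp a.
Proof. by rewrite !mem_supp coefZ mulf_eq0 negb_or => /andP[]. Qed.

Lemma supp_mono p q : p \in supp (mono q) -> p = q.
Proof.
rewrite mem_supp coef_mono; have [->//|_] := eqVneq q p.
by rewrite /= mulr0n eqxx.
Qed.

Lemma supp0 p : p \notin supp 0.
Proof. by rewrite mem_supp negbK -(scale0r 0) coefZ mul0r. Qed.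

Lemma split_monomial a p :
  exists2 c, p \notin supp c & a = coef p a *: mono p + c.
Proof.
exists (a - coef p a *: mono p); last by rewrite addrC subrK.
rewrite mem_supp negbK -scaleN1r coefD !coefZ coef_mono eqxx.
by rewrite mulr1 mulN1r subrr.
Qed.

Lemma step_source a b : step a b -> exists2 p, p \in supp a & reducible p.
Proof.
move=> /stepP[p [q [x [c [pq x0 cN [-> _]]]]]]; exists p; last by exists q.
rewrite mem_supp coefD coefZ coef_mono eqxx mulr1.
by move: cN; rewrite mem_supp negbK => /eqP->; rewrite addr0.
Qed.

Lemma irreducible_suppP a :
  irreducible a <-> forall p, p \in supp a -> ~ reducible p.
Proof.
split=> [irr p pa [q pq]|irr b /step_source[p /irr]]; last by [].
have [c cN aE] := split_monomial a p.
apply: (irr (coef p a *: q + c)); apply/stepP.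
by exists p, q, (coef p a), c; split; rewrite -?mem_supp.
Qed.

Lemma irreducibleD a b : irreducible a -> irreducible b -> irreducible (a + b).
Proof.
move=> /irreducible_suppP ra /irreducible_suppP rb.
by apply/irreducible_suppP => p /supp_addP[/ra|/rb].
Qed.

Lemma irreducible0 : irreducible 0.
Proof. by apply/irreducible_suppP => p; rewrite (negPf (supp0 p)). Qed.

Lemma steps_irreducible a b : irreducible a -> steps a b -> b = a.
Proof.
move=> ra ab; elim: ab ra => [c d cd /(_ d)||c d e _ IH1 _ IH2 rc] //.
by have dc := IH1 rc; rewrite IH2 ?dc.
Qed.

Lemma steps_addr_irreducible a b c :
  irreducible c -> steps a b -> steps (a + c) (b + c).
Proof.
move=> /irreducible_suppP rc.
elim=> [d e /stepP|d|d e f _ IH1 _ IH2]; last 2 first.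
- exact: rt_refl.
- exact: rt_trans IH1 IH2.
move=> [p [q [x [k [pq x0 kN [-> ->]]]]]].
apply: rt_step; apply/stepP; exists p, q, x, (k + c); rewrite !addrA; split=> //.
by apply/negP => /supp_addP[|/rc]; [apply/negP|apply; exists q].
Qed.

Lemma monomial_steps p m x a :
  rule p m -> p \notin supp a -> steps (x *: mono p + a) (x *: m + a).
Proof.
move=> pq pa; have [->|x0] := eqVneq x 0.
  by rewrite !scale0r; apply: rt_refl.
by apply: rt_step; apply/stepP; exists p, m, x, a.
Qed.

Context (lt : rel T).
Hypothesis lt_wf : well_founded lt.
Hypothesis lt_irr : forall p, lt p p = false.
Hypothesis lt_trans : forall p q r, lt p q -> lt q r -> lt p r.
Hypothesis lt_total : forall p q, p != q -> lt p q || lt q p.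

Let below p a := forall q, q \in supp a -> lt q p.

Hypothesis rule_below : forall p m, rule p m -> below p m.

Lemma belowD p a b : below p a -> below p b -> below p (a + b).
Proof. by move=> pa pb q /supp_addP[/pa|/pb]. Qed.

Lemma below_scale p x a : below p a -> below p (x *: a).
Proof. by move=> pa q /supp_scale/pa. Qed.

Lemma below_trans p q a : lt q p -> below q a -> below p a.
Proof. by move=> qp qa r /qa/lt_trans; apply. Qed.

Lemma below_notin p a : below p a -> p \notin supp a.
Proof. by move=> pa; apply/negP => /pa; rewrite lt_irr. Qed.

Lemma steps_below p a b : below p a -> steps a b -> below p b.
Proof.
move=> pa ab; elim: ab pa => [c d /stepP|//|c d e _ IH1 _ IH2 /IH1/IH2 //].
move=> [q [r [x [k [qr x0 kN [-> ->]]]]]] dom.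
apply: belowD.
  apply: below_scale; apply: below_trans (rule_below qr); apply: dom.
  rewrite mem_supp coefD coefZ coef_mono eqxx mulr1.
  by move: kN; rewrite mem_supp negbK => /eqP->; rewrite addr0.
move=> s sk; apply: dom; rewrite mem_supp coefD coefZ coef_mono.
case: (eqVneq q s) => [qs|_]; first by rewrite qs sk in kN.
by rewrite mulr0 add0r -mem_supp.
Qed.

Lemma leading_monomial a : a != 0 ->
  exists p c, [/\ p \in supp a, below p c & a = coef p a *: mono p + c].
Proof.
move=> a0; have /fset0Pn[q qa] : supp a != fset0.
  by apply: contra_neq a0; apply: supp_eq0.
have [p pa pmax] : exists2 p, p \in supp a &
    forall r, r \in supp a -> r != p -> lt r p.
  suff: exists2 p, p \in (supp a : seq T) &
    forall r, r \in (supp a : seq T) -> r != p -> lt r p by [].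
  have : q \in (supp a : seq T) by [].
  elim: (supp a : seq T) q {qa} => [//|r s IH] q _.
  have [s0|[q' q's]] : s = [::] \/ exists q', q' \in s.
      by case: (s) => [|q' s']; [left|right; exists q'; rewrite mem_head].
    exists r; rewrite ?mem_head // => k.
    by rewrite s0 inE => /eqP->; rewrite eqxx.
  have [p ps pmax] := IH _ q's.
  have [->|rp] := eqVneq r p.
    exists p; rewrite ?mem_head // => k.
    by rewrite inE => /orP[/eqP->|/pmax//]; rewrite eqxx.
  case/orP: (lt_total rp) => [ltrp|ltpr].
    exists p; first by rewrite inE ps orbT.
    by move=> k; rewrite inE => /orP[/eqP->//|/pmax].
  exists r; first exact: mem_head.
  move=> k; rewrite inE => /orP[/eqP->|/pmax kp _]; first by rewrite eqxx.
  by have [->//|/kp/lt_trans] := eqVneq k p; apply.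
have [c cN aE] := split_monomial a p; exists p, c; split=> // r rc.
have rp : r != p by apply: contraNneq cN => <-.
apply: pmax => //; rewrite aE mem_supp coefD coefZ coef_mono.
by rewrite [p == r]eq_sym (negPf rp) mulr0 add0r -mem_supp.
Qed.

(** Well-founded induction on the leading basis vector [p].  If [p] is
    reducible, one step makes every basis vector smaller than [p]; otherwise the
    rest of the element is smaller than [p] and reduces on its own, with the
    term in [p] carried along. *)
Lemma irreducible_form a : exists2 b, steps a b & irreducible b.
Proof.
suff form p x c : below p c ->
    exists2 b, steps (x *: mono p + c) b & irreducible b.
  have [->|/leading_monomial[p [c [_ pc ->]]]] := eqVneq a 0; last exact: form.
  by exists 0; [apply: rt_refl|apply: irreducible0].
elim/(well_founded_ind lt_wf): p => p IH in x c *.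
have {}IH d : below p d -> exists2 b, steps d b & irreducible b.
  have [-> _|] := eqVneq d 0.
    by exists 0; [apply: rt_refl|apply: irreducible0].
  move=> /leading_monomial[q [e [qd qe dE]]] /(_ q qd) qp.
  by rewrite dE; apply: IH.
move=> pc; have [[m pm]|irr] := pselect (reducible p).
  have [|b stp irrb] := IH (x *: m + c).
    by apply: belowD => //; apply/below_scale/rule_below.
  exists b => //; apply: rt_trans stp.
  by apply: monomial_steps => //; apply: below_notin.
have [b cb irrb] := IH _ pc.
have irrp : irreducible (x *: mono p).
  by apply/irreducible_suppP => q /supp_scale/supp_mono->.
exists (b + x *: mono p); last exact: irreducibleD.
by rewrite addrC; apply: steps_addr_irreducible.
Qed.

(** A step need not survive the addition of [c], since the rewritten basis
    vector may cancel against [c].  Rewriting that vector on both sides, with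
    whatever coefficient it has there (possibly 0), still gives a common
    reduct. *)
Lemma step_join a b c : step a b ->
  exists d, steps (a + c) d /\ steps (b + c) d.
Proof.
move=> /stepP[p [m [x [k [pm x0 kN [-> ->]]]]]].
have [e eN cE] := split_monomial c p; set y := coef p c in cE.
exists ((x + y) *: m + (k + e)); rewrite cE; split.
  rewrite addrACA -scalerDl; apply: monomial_steps => //.
  by apply/negP => /supp_addP[]; apply/negP.
rewrite [x *: m + k + _]addrACA [x *: m + _]addrC scalerDl.
rewrite [x *: m + y *: m]addrC -!addrA.
apply: monomial_steps => //.
apply/negP => /supp_addP[/supp_scale|/supp_addP[]]; apply/negP => //.
by apply: below_notin; apply: rule_below.
Qed.

Hypothesis confl :
  forall a b c, steps a b -> steps a c -> exists d, steps b d /\ steps c d.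

Let normal_form a b := steps a b /\ irreducible b.

(** Under confluence, replacing a summand by a reduct of it does not change the
    normal form of the sum. *)
Lemma normal_form_steps_addr a b c d :
  steps a b -> normal_form (a + c) d -> normal_form (b + c) d.
Proof.
move=> ab; elim: ab d => [e f ef|//|e f g _ IH1 _ IH2] d; last by move/IH1/IH2.
have [h [eh fh]] := step_join c ef.
move=> [ed irrd]; split=> //; have [k [hk dk]] := confl eh ed.
by apply: rt_trans fh _; rewrite -(steps_irreducible irrd dk).
Qed.

Lemma normal_form0D a b :
  normal_form a 0 -> normal_form b 0 -> normal_form (a + b) 0.
Proof.
move=> [a0 _] [b0 irr0]; have [d abd irrd] := irreducible_form (a + b).
have : normal_form (a + b) d by [].
move=> /(normal_form_steps_addr a0); rewrite addrC.
move=> /(normal_form_steps_addr b0); rewrite addr0.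
by move=> [/(steps_irreducible irr0) d0 _]; rewrite -d0.
Qed.

Lemma normal_form_sub0 a b : steps a b -> normal_form (a - b) 0.
Proof.
move=> ab; have [d abd irrd] := irreducible_form (a - b).
have /(normal_form_steps_addr ab) [] : normal_form (a - b) d by [].
by rewrite subrr => /(steps_irreducible irreducible0) <-.
Qed.

End LinearRewriting.

(** * Rewriting in a polygraph *)

Section Polygraphs.
Context (K : fieldType) (X : polygraph K).
Implicit Types (a b c m : freealg K (cells0 X)) (p u v w : {fmonom (cells0 X)}).

Definition rewriting_rule p m : Prop :=
  exists (al : cells1 X) (s v w : {fmonom (cells0 X)}),
    [/\ src al = << s >>, p = (v * s * w)%M & m = sandwich v (tgt al) w].

Definition reducible p : Prop := exists m, rewriting_rule p m.

Lemma rewriting_stepP a b : rewriting_step a b <->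
  exists p m x c, [/\ rewriting_rule p m, x != 0, p \notin msupp c
    & a = x *: << p >> + c /\ b = x *: m + c].
Proof.
split=> [[al s v w x c srcE x0 cN]|].
  exists (v * s * w)%M, (sandwich v (tgt al) w), x, c.
  split; [|exact: x0|exact: cN|split; exact: erefl].
  exists al, s, v, w; split; [exact: srcE|exact: erefl|exact: erefl].
move=> [p [m [x [c [[al [s [v [w [srcE pE mE]]]]] x0 cN [-> ->]]]]]].
rewrite mE; subst p; exact: (RewritingStep srcE x0 cN).
Qed.

Let coefD p a b : mcoeff p (a + b) = mcoeff p a + mcoeff p b.
Proof. exact: mcoeffD. Qed.
Let coefZ p x a : mcoeff p (x *: a) = x * mcoeff p a.
Proof. exact: mcoeffZ. Qed.
Let coef_mono p u : mcoeff u (<< p >> : freealg K (cells0 X)) = (p == u)%:R.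
Proof. exact: mcoeffU1. Qed.
Let mem_supp a p : (p \in msupp a) = (mcoeff p a != 0).
Proof. by rewrite mcoeff_neq0. Qed.
Let supp_eq0 a : msupp a = fset0 -> a = 0.
Proof. by move/eqP; rewrite msupp_eq0 => /eqP. Qed.

Lemma reducedP a : reduced a <-> forall p, p \in msupp a -> ~ reducible p.
Proof.
exact: (irreducible_suppP coefD coefZ coef_mono mem_supp rewriting_stepP).
Qed.

Lemma reduced_monomialsP p : reduced_monomials X p <-> ~ reducible p.
Proof.
split=> [/reducedP/(_ p)|irr]; first by apply; rewrite msuppU1 in_fset1.
by apply/reducedP => q /msupp_monomial->.
Qed.

Lemma reducedE a : reduced a <-> supported_on (reduced_monomials X) a.
Proof.
split=> [/reducedP h p /h|h]; first by move/reduced_monomialsP.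
by apply/reducedP=> p /h/reduced_monomialsP.
Qed.

Lemma rewrites_ideal a b :
  rewrites a b -> generated_ideal (relations (X := X)) (a - b).
Proof.
elim=> [c d /rewriting_stepP|c|c d e _ IH1 _ IH2]; last 2 first.
- by rewrite subrr; apply: ideal0.
- by rewrite -(subrKA d); apply: idealD.
move=> [p [m [x [k [[al [s [v [w [srcE pE mE]]]]] _ _ [-> ->]]]]]].
rewrite (addrC (x *: << p >>)) (addrC (x *: m)) opprD addrACA subrr add0r.
rewrite -scalerBr mE pE -sandwich_monomial -srcE -sandwichB.
apply/generated_ideal_scale/idealM/ideal_gen; exists al; exact: erefl.
Qed.

Context (le : rel {fmonom (cells0 X)}).
Hypotheses (mo : monomial_order le) (compat : compatible X le).

Lemma strict_wf : well_founded (strict le).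
Proof. by case: mo. Qed.

Lemma strict_irrefl u : strict le u u = false.
Proof. by rewrite /strict eqxx. Qed.

Lemma strict_trans u v w : strict le u v -> strict le v w -> strict le u w.
Proof.
case: mo => _ anti tr _ _ /andP[uv luv] /andP[vw lvw].
rewrite /strict (tr v) // andbT; apply: contraNneq uv => uw.
by apply/eqP/anti; rewrite luv uw lvw.
Qed.

Lemma strict_total u v : u != v -> strict le u v || strict le v u.
Proof.
by case: mo => tot _ _ _ _ uv; rewrite /strict uv eq_sym uv; apply: tot.
Qed.

Lemma rewriting_rule_dominates p m : rewriting_rule p m -> dominates le p m.
Proof.
move=> [al [s [v [w [srcE -> ->]]]]] k /msupp_sandwich[q qt ->].
case: mo => _ _ _ _; apply; have [s' [srcE' dom]] := compat al.
have <- : s' = s by apply: (@monomial_inj K); rewrite -srcE -srcE'.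
exact: dom.
Qed.

Lemma rewriting_gt_strict u v : rewriting_gt u v -> strict le v u.
Proof.
elim=> [al s k srcE kt|m k w w' _ mk|m k w _ IH1 _ IH2].
- have [s' [srcE' dom]] := compat al.
  have <- : s' = s by apply: (@monomial_inj K); rewrite -srcE -srcE'.
  exact: dom.
- by case: mo => _ _ _ _; apply.
- exact: strict_trans IH2 IH1.
Qed.

Lemma compatible_terminates : terminates X.
Proof.
move=> u; elim/(well_founded_ind strict_wf): u => u IH.
by constructor => v /rewriting_gt_strict/IH.
Qed.

Lemma compatible_left_monomial : left_monomial X.
Proof.
move=> al; have [s [srcE dom]] := compat al; exists s; split; first exact: srcE.
by apply/negP => /dom; rewrite strict_irrefl.
Qed.

Lemma reduced_form a : exists2 b, rewrites a b & reduced b.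
Proof.
exact: (irreducible_form coefD coefZ coef_mono mem_supp supp_eq0 rewriting_stepP
  strict_wf strict_irrefl strict_trans strict_total rewriting_rule_dominates).
Qed.

Lemma reduced_form_monomial p : reducible p ->
  exists b, [/\ rewrites << p >> b, reduced b & dominates le p b].
Proof.
move=> [m pm]; have [b mb redb] := reduced_form m.
have pN : p \notin msupp (0 : freealg K (cells0 X)) by rewrite msupp0.
have := monomial_steps rewriting_stepP 1 pm pN; rewrite !scale1r !addr0 => step.
exists b; split; [exact: rt_trans step mb | exact: redb |].
exact: (steps_below coefD coefZ coef_mono mem_supp rewriting_stepP strict_trans
  rewriting_rule_dominates (rewriting_rule_dominates pm) mb).
Qed.

(** By confluence, rewriting to 0 is additive and holds for the difference of
    the two sides of any step; such differences span the ideal. *)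
Lemma reduced_ideal0 a : confluent X ->
  generated_ideal (relations (X := X)) a -> reduced a -> a = 0.
Proof.
move=> confl Ia reda.
have zero_sub b c : rewrites b c ->
    rewrites (b - c) 0 /\ reduced (0 : freealg K (cells0 X)).
  exact: (normal_form_sub0 coefD coefZ coef_mono mem_supp supp_eq0
    rewriting_stepP strict_wf strict_irrefl strict_trans strict_total
    rewriting_rule_dominates confl).
have [a0 _] : rewrites a 0 /\ reduced (0 : freealg K (cells0 X)).
  move: a Ia {reda}; apply: generated_ideal_span => [|b c|x u r v [al ->]].
  - by have := zero_sub 0 0; rewrite subrr; apply; apply: rt_refl.
  - exact: (normal_form0D coefD coefZ coef_mono mem_supp supp_eq0
      rewriting_stepP strict_wf strict_irrefl strict_trans strict_total
      rewriting_rule_dominates confl).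
  have [s [srcE _]] := compat al.
  have rule : rewriting_rule (u * s * v)%M (sandwich u (tgt al) v).
    by exists al, s, u, v.
  have pN : (u * s * v)%M \notin msupp (0 : freealg K (cells0 X)).
    by rewrite msupp0.
  have := monomial_steps rewriting_stepP x rule pN.
  rewrite sandwichB scalerBr srcE sandwich_monomial !addr0.
  exact: zero_sub.
exact/esym/(steps_irreducible reda a0).
Qed.

End Polygraphs.

(** * Presentations and linear bases *)

Section Presentations.
Context (K : fieldType) (A : algType K).

Lemma extension_monomial (S : choiceType) (g : S -> A) u :
  extension g << u >> = word_eval g u.
Proof. by rewrite /extension mmapU /= scale1r mul1r. Qed.

Lemma extension_ideal (S : choiceType) (g : S -> A) (G : set (freealg K S)) :
    (forall r, G r -> extension g r = 0) ->
  forall a, generated_ideal G a -> extension g a = 0.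
Proof.
move=> Gg a; elim=> [|r /Gg //|b c _ b0 _ c0|b r c _ r0].
- exact: raddf0.
- by rewrite raddfD /= b0 c0 addr0.
- by rewrite !rmorphM /= r0 mulr0 mul0r.
Qed.

(** The first isomorphism theorem: presenting [A] means that the evaluation of
    the free algebra in [A] is onto, with the ideal of relations as kernel. *)
Lemma presentsP (X : polygraph K) (g : cells0 X -> A) :
  presents X g <->
    (forall x, exists a, extension g a = x) /\
    (forall a, extension g a = 0 <-> generated_ideal (relations (X := X)) a).
Proof.
pose Q := quotient (relations (X := X)).
have piP a b : reflect (generated_ideal (relations (X := X)) (a - b))
    (\pi_Q a == \pi_Q b).
  by rewrite -Quotient.idealrBE; apply: asboolP.
split=> [[phi [[psi phiK psiK] gE]]|[surj kerP]].
  split=> [x|a]; first by exists (repr (psi x)); rewrite gE reprK psiK.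
  have g0 : phi (\pi_Q 0) = 0 by rewrite -gE raddf0.
  split=> [a0|Ia].
    rewrite -[a]subr0; apply/piP/eqP/(can_inj phiK).
    by rewrite -gE a0 g0.
  by rewrite gE -g0; congr phi; apply/eqP/piP; rewrite subr0.
have eqg a b : (extension g a == extension g b) = (\pi_Q a == \pi_Q b).
  rewrite -subr_eq0 -raddfB; apply/eqP/piP; apply kerP.
exists (fun q : Q => extension g (repr q)); split; last first.
  by move=> a; apply/eqP; rewrite eqg reprK.
pose lift x := projT1 (cid (surj x)).
have liftK x : extension g (lift x) = x by exact: (projT2 (cid (surj x))).
exists (fun x => \pi_Q (lift x)) => [q|x].
  by apply/eqP; rewrite -[q in _ == q]reprK -eqg liftK.
by rewrite -[RHS]liftK; apply/eqP; rewrite eqg reprK.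
Qed.

Lemma rewrites_extension (X : polygraph K) (g : cells0 X -> A) a b :
    (forall al : cells1 X, extension g (src al) = extension g (tgt al)) ->
  rewrites a b -> extension g a = extension g b.
Proof.
move=> gX /rewrites_ideal Iab; apply/eqP; rewrite -subr_eq0 -raddfB.
apply/eqP; apply: extension_ideal Iab => r [al ->].
by rewrite raddfB /= gX subrr.
Qed.

Lemma decompositionP (S : choiceType) (g : S -> A) (B : set {fmonom S}) u c :
  linear_basis g B ->
  decomposition g B u = c <->
    supported_on B c /\ extension g c = extension g << u >>.
Proof.
move=> basis; have [d [Bd dU]] := basis (extension g << u >>).
have dec : supported_on B (decomposition g B u) /\
    extension g (decomposition g B u) = extension g << u >>.
  by apply: (@xgetPex _ 0 [set c | supported_on B c /\
       extension g c = extension g << u >>]); exists d.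
split=> [<- //|/dU <-]; exact/esym/dU.
Qed.

Lemma linear_basis_inj (S : choiceType) (g : S -> A) (B : set {fmonom S}) a b :
    linear_basis g B -> supported_on B a -> supported_on B b ->
  extension g a = extension g b -> a = b.
Proof.
move=> basis Ba Bb ab; have [d [_ dU]] := basis (extension g b).
have <- : d = a by apply: dU.
by apply: dU.
Qed.

End Presentations.

(** * The grading of a homogeneous algebra *)

Section Grading.
Context (K : fieldType).

Section Component.
Context (S : choiceType).
Implicit Types (a b : freealg K S) (u v : {fmonom S}).

Definition component (n : nat) a : freealg K S :=
  [malg u in msupp a => if fdeg u == n then a@_u else 0].

Lemma component_coef n a u :
  (component n a)@_u = if fdeg u == n then a@_u else 0.
Proof.
rewrite /component mcoeffE; case: ifP => // /negbT ua.
by rewrite (mcoeff_outdom ua) if_same.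
Qed.

Lemma componentD n a b : component n (a + b) = component n a + component n b.
Proof.
apply/malgP => u; rewrite mcoeffD !component_coef mcoeffD.
by case: ifP; rewrite ?addr0.
Qed.

Lemma component0 n : component n 0 = 0.
Proof. by apply/malgP => u; rewrite component_coef mcoeff0 if_same. Qed.

Lemma msupp_component n a u : u \in msupp (component n a) -> u \in msupp a.
Proof.
by rewrite -!mcoeff_neq0 component_coef; case: ifP => // _; rewrite eqxx.
Qed.

Lemma homogeneous_component n m a : homogeneous m a ->
  component n a = if m == n then a else 0.
Proof.
move=> am; apply/malgP => u; rewrite component_coef.
have [/am -> |/mcoeff_outdom ua] := boolP (u \in msupp a).
  by case: ifP => //; rewrite mcoeff0.
by rewrite ua; case: (m == n); rewrite ?mcoeff0 ?ua if_same.
Qed.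

Lemma homogeneous_scale n x a : homogeneous n a -> homogeneous n (x *: a).
Proof. by move=> an u /msupp_scale/an. Qed.

Lemma homogeneousB n a b :
  homogeneous n a -> homogeneous n b -> homogeneous n (a - b).
Proof.
move=> an bn u /msupp_addP[/an //|]; rewrite msuppN; exact: bn.
Qed.

Lemma homogeneous_sandwich n u a v : homogeneous n a ->
  homogeneous (fdeg u + n + fdeg v) (sandwich u a v).
Proof. by move=> an w /msupp_sandwich[m /an mn ->]; rewrite !fdegM mn. Qed.

Lemma homogeneous_monomial u : homogeneous (fdeg u) (<< u >> : freealg K S).
Proof. by move=> v /msupp_monomial->. Qed.

(** A generator multiplied by monomials is homogeneous, so each of its
    components is either the whole product or 0. *)
Lemma generated_ideal_component (G : set (freealg K S)) N n a :
    (forall r, G r -> homogeneous N r) ->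
  generated_ideal G a -> generated_ideal G (component n a).
Proof.
move=> GN; move: a; apply: generated_ideal_span => [|a b Ia Ib|x u r v Gr].
- by rewrite component0; apply: ideal0.
- by rewrite componentD; apply: idealD.
have /homogeneous_component-> :=
  homogeneous_scale (x := x) (homogeneous_sandwich (u := u) (v := v) (GN _ Gr)).
case: eqP => _; last exact: ideal0.
exact/generated_ideal_scale/idealM/ideal_gen.
Qed.

End Component.

Context (A : algType K).

(** A letter is the image of an element of degree 1 over the other generators,
    hence a word of length [n] is the image of an element of degree [n]. *)
Lemma degreewise_lift (S T : choiceType) (g : S -> A) (h : T -> A) :
    (forall x, degree_part h 1 (g x)) ->
  forall a : freealg K S, exists b : freealg K T,
    extension h b = extension g a /\
    forall n, extension h (component n b) = extension g (component n a).
Proof.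
move=> deg1; apply: freealg_ind => [|a b [a' [a'E a'n]] [b' [b'E b'n]]|x u].
- exists 0; split=> [|n]; rewrite ?component0 !raddf0; exact: erefl.
- exists (a' + b'); split=> [|n]; rewrite ?componentD !raddfD /=.
    by rewrite a'E b'E.
  by rewrite a'n b'n.
have [b [bh bE]] : exists b : freealg K T,
    homogeneous (fdeg u) b /\ extension h b = extension g << u >>.
  rewrite extension_monomial fdegE /word_eval.
  elim: (u : seq S) => [|y s [b [bh bE]]].
    exists 1; rewrite big_nil; split; last exact: rmorph1.
    by move=> w /msupp_monomial->; exact: fdeg1.
  have [c [ch cE]] := deg1 y.
  exists (c * b); rewrite big_cons -bE -cE; split; last exact: rmorphM.
  by move=> w /msuppM_le[w1 [w2 [/ch w1h /bh w2h ->]]]; rewrite fdegM w1h w2h.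
have bx := homogeneous_scale (x := x) bh.
have ux := homogeneous_scale (x := x) (@homogeneous_monomial S u).
exists (x *: b); split=> [|n].
  by rewrite !linearZ /= bE.
rewrite (homogeneous_component n bx) (homogeneous_component n ux).
by case: eqP => _; [rewrite !linearZ /= bE | rewrite !raddf0].
Qed.

(** The degree parts of [A] are independent: lifted to the generators of a
    homogeneous presentation, a relation in [A] becomes a member of a
    homogeneous ideal, which contains all its components. *)
Lemma extension_component (N : nat) (deg : nat -> set A) (S : choiceType)
    (g : S -> A) n a :
    homogeneous_grading N deg -> (forall x, deg 1%N (g x)) ->
  extension g a = 0 -> extension g (component n a) = 0.
Proof.
move=> [Y [h [homY /presentsP[_ kerP] ->]]] deg1.
have [b [bE bn]] := degreewise_lift deg1 a.
rewrite -bE -bn => /kerP Ib; apply/kerP.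
apply: (generated_ideal_component (N := N)) Ib => r [al ->].
by have [hs ht] := homY al; apply: homogeneousB.
Qed.

End Grading.

(** * From convergent presentations to PBW bases *)

Section Factors.
Context (S : choiceType).
Implicit Types (u v w : {fmonom S}).

Lemma fdeg_factor v u w : (fdeg u <= fdeg (v * u * w)%M)%N.
Proof. by rewrite !fdegM -addnA addnCA leq_addr. Qed.

(** A word shorter than [N] has no factor of length [N], so the condition on
    factors is void. *)
Lemma local_short (B : set {fmonom S}) N u :
    (forall u, B u <->
       forall v u' w, u = (v * u' * w)%M -> fdeg u' = N -> B u') ->
  (fdeg u < N)%N -> B u.
Proof.
move=> local uN; apply/local => v u' w uE u'N.
by have := fdeg_factor v u' w; rewrite -uE u'N leqNgt uN.
Qed.

Lemma word_eval_letter (K : fieldType) (A : algType K) (g : S -> A) x :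
  word_eval g (fmu x) = g x.
Proof. by rewrite /word_eval fmU big_seq1. Qed.

End Factors.

Section ReducedMonomials.
Context (K : fieldType) (X : polygraph K).

Lemma reducible_factor v u w :
  reducible (X := X) u -> reducible (X := X) (v * u * w)%M.
Proof.
move=> [m [al [s [v' [w' [srcE -> _]]]]]].
exists (sandwich (v * v')%M (tgt al) (w' * w)%M), al, s, (v * v')%M, (w' * w)%M.
by rewrite !mulmA.
Qed.

Lemma reduced_monomials_local N u : homogeneous_polygraph X N ->
  reduced_monomials X u <->
  forall v u' w, u = (v * u' * w)%M -> fdeg u' = N -> reduced_monomials X u'.
Proof.
move=> hom; split=> [/reduced_monomialsP irr v u' w uE _|irr].
  by apply/reduced_monomialsP => /(reducible_factor v w); rewrite -uE.
apply/reduced_monomialsP => -[m [al [s [v [w [srcE uE _]]]]]].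
have sN : fdeg s = N.
  by have [+ _] := hom al; apply; rewrite srcE msuppU1 in_fset1.
have /reduced_monomialsP := irr _ _ _ uE sN; apply.
by exists (sandwich mone (tgt al) mone), al, s, mone, mone; rewrite mul1m mulm1.
Qed.

End ReducedMonomials.

Section PBWOfConvergent.
Context (K : fieldType) (A : algType K) (X : polygraph K) (g : cells0 X -> A).
Context (N : nat) (le : rel {fmonom (cells0 X)}).
Hypotheses (presX : presents X g) (homX : homogeneous_polygraph X N).
Hypotheses (confl : confluent X) (mo : monomial_order le).
Hypothesis (compat : compatible X le).

Let B := reduced_monomials X.

Lemma cells_extension al : extension g (src al) = extension g (tgt al).
Proof.
have [_ kerP] := (presentsP g).1 presX.
apply/eqP; rewrite -subr_eq0 -raddfB; apply/eqP/kerP/ideal_gen.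
exists al; exact: erefl.
Qed.

Lemma convergent_linear_basis : linear_basis g B.
Proof.
have [surj kerP] := (presentsP g).1 presX.
move=> x; have [a <-] := surj x; have [b ab redb] := reduced_form mo compat a.
exists b; split.
  split; first exact/reducedE.
  exact/esym/(rewrites_extension cells_extension ab).
move=> c [Bc cE]; apply/eqP; rewrite -subr_eq0; apply/eqP.
apply: (reduced_ideal0 mo compat confl).
  apply/kerP; rewrite raddfB /= cE (rewrites_extension cells_extension ab).
  exact: subrr.
apply/reducedE => u /msupp_addP[|].
  by move: u; apply/reducedE.
by rewrite msuppN => /Bc.
Qed.

(** The decomposition of [u] is its normal form, reached by steps that
    decrease the order. *)
Lemma convergent_decomposition u : weakly_dominates le u (decomposition g B u).
Proof.
have basis := convergent_linear_basis.
have [ru|irr] := pselect (reducible (X := X) u); last first.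
  left; apply/esym/(decompositionP _ _ basis); split; last exact: erefl.
  by move=> v /msupp_monomial->; apply/reduced_monomialsP.
have [b [ub redb dom]] := reduced_form_monomial mo compat ru.
have -> : decomposition g B u = b.
  apply/(decompositionP _ _ basis); split; first exact/reducedE.
  exact/esym/(rewrites_extension cells_extension ub).
by right.
Qed.

Lemma convergent_PBW_basis : PBW_basis g N le B.
Proof.
split; first exact: convergent_linear_basis.
  by move=> u v _ _; apply: convergent_decomposition.
by move=> u; apply: reduced_monomials_local.
Qed.

Lemma convergent_degree1 : (2 <= N)%N ->
  degree1_generating_set (degree_part g) g.
Proof.
move=> N2; have [surj _] := (presentsP g).1 presX.
split=> // [x y xy|x]; last first.
  exists << fmu x >>; split; first by move=> u /msupp_monomial->; exact: fdegU.
  by rewrite extension_monomial word_eval_letter.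
have Bletter z : supported_on B (<< fmu z >> : freealg K (cells0 X)).
  move=> u /msupp_monomial->.
  have [_ _ local] := convergent_PBW_basis.
  by apply: (local_short local); rewrite fdegU.
have : fmu x = fmu y.
  apply: (@monomial_inj K).
  apply: (linear_basis_inj convergent_linear_basis (Bletter x) (Bletter y)).
  by rewrite !extension_monomial !word_eval_letter.
by move=> /(congr1 (fun u : {fmonom _} => u : seq _)); rewrite !fmU => -[].
Qed.

End PBWOfConvergent.

(** * From PBW bases to convergent presentations *)

Section PolygraphOfPBW.
Context (K : fieldType) (A : algType K) (S : choiceType) (g : S -> A).
Context (N : nat) (le : rel {fmonom S}) (B : set {fmonom S}).
Hypotheses (N2 : (2 <= N)%N) (mo : monomial_order le) (pbw : PBW_basis g N le B).

Let X := PBW_polygraph g N B.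

Let basis : linear_basis g B. Proof. by case: pbw. Qed.
Let local u : B u <-> forall v u' w, u = (v * u' * w)%M -> fdeg u' = N -> B u'.
Proof. by case: pbw. Qed.

Lemma decomposition_fixed u : decomposition g B u = << u >> <-> B u.
Proof.
split=> [/(decompositionP _ _ basis)[Bu _]|Bu].
  by apply: Bu; rewrite msuppU1 in_fset1.
apply/(decompositionP _ _ basis); split; last exact: erefl.
by move=> v /msupp_monomial->.
Qed.

Lemma PBW_cells_factor (al : cells1 X) s : src al = << s >> ->
  fdeg s = N /\ ~ B s.
Proof.
case: al => -[u v] /= [Bu Bv uvN uv_dec] /monomial_inj <-; split=> //.
by move=> /decomposition_fixed dec; apply/uv_dec/esym.
Qed.

(** A word of length [N >= 2] is a letter followed by a word of length [N - 1],
    and both belong to [B] because they are shorter than [N]. *)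
Lemma PBW_reducible u : fdeg u = N -> ~ B u -> reducible (X := X) u.
Proof.
move=> uN nBu.
have [v [w [uE vN wN]]] : exists v w,
    [/\ u = (v * w)%M, (fdeg v < N)%N & (fdeg w < N)%N].
  move: uN; rewrite fdegE; case uE: (u : seq S) => [|x s] sN.
    by move: N2; rewrite -sN.
  exists (fmu x), (FMonom s); split; last 2 first.
  - by rewrite fdegU.
  - by rewrite fdegE -sN.
  by apply/val_inj; rewrite /= fmM fmU uE.
have [Bv Bw] := (local_short local vN, local_short local wN).
have cell : [/\ B (v, w).1, B (v, w).2, fdeg ((v, w).1 * (v, w).2)%M = N
    & << ((v, w).1 * (v, w).2)%M >> <>
      decomposition g B ((v, w).1 * (v, w).2)%M].
  split=> //=; rewrite -?uE //.
  by move=> /esym/decomposition_fixed.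
pose al : cells1 X := exist _ (v, w) cell.
exists (sandwich mone (tgt al) mone), al, u, mone, mone.
by rewrite mul1m mulm1; split=> //; rewrite uE.
Qed.

Lemma PBW_reduced_monomials : reduced_monomials X = B.
Proof.
apply/seteqP; split=> u.
  move=> /reduced_monomialsP irr; apply/local => v u' w uE u'N.
  apply: contrapT => /(PBW_reducible u'N) red; apply: irr; rewrite uE.
  exact: (reducible_factor (X := X) v w red).
move=> Bu; apply/reduced_monomialsP => -[m [al [s [v [w [srcE uE _]]]]]].
have [sN] := PBW_cells_factor srcE; apply.
exact: (local u).1 Bu _ _ _ uE sN.
Qed.

Lemma PBW_compatible : compatible X le.
Proof.
case: pbw => _ dom _ -[[u v] /= [Bu Bv uvN uv_dec]].
exists (u * v)%M; split; first exact: erefl.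
by case: (dom u v Bu Bv).
Qed.

Lemma PBW_cells_extension (al : cells1 X) :
  extension g (src al) = extension g (tgt al).
Proof.
case: al => -[u v] /= _.
have [_ ->] :=
  (decompositionP (u * v)%M (decomposition g B (u * v)%M) basis).1 erefl.
exact: erefl.
Qed.

(** In degree [n <> N], the component of the decomposition of a word of length
    [N] is an element supported on [B] whose image in the algebra is 0. *)
Lemma PBW_homogeneous deg :
    homogeneous_grading N deg -> (forall x, deg 1%N (g x)) ->
  homogeneous_polygraph X N.
Proof.
move=> grad deg1 -[[u v] /= [_ _ uvN _]]; set p := (u * v)%M in uvN *.
split; first by rewrite -uvN; apply: homogeneous_monomial.
have [Bc cE] := (decompositionP p (decomposition g B p) basis).1 erefl.
move: (decomposition g B p) Bc cE => c Bc cE w wc; apply: contrapT => /eqP wN.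
have cp0 : extension g (c - << p >>) = 0 by rewrite raddfB /= cE subrr.
have := extension_component (fdeg w) grad deg1 cp0.
have ph : homogeneous N (<< p >> : freealg K S).
  by rewrite -uvN; apply: homogeneous_monomial.
have pN : component (fdeg w) (- << p >> : freealg K S) = 0.
  rewrite (@homogeneous_component _ _ _ N) ?[N == _]eq_sym ?(negPf wN) //.
  by move=> k; rewrite msuppN; apply: ph.
rewrite componentD pN addr0 => comp0.
have c0 : component (fdeg w) c = 0.
  apply: (linear_basis_inj basis).
  - by move=> k /msupp_component/Bc.
  - by move=> k; rewrite msupp0.
  - by rewrite comp0 raddf0.
move: wc; rewrite -mcoeff_neq0 => /eqP; apply.
by have := component_coef (fdeg w) c w; rewrite c0 mcoeff0 eqxx.
Qed.

(** An element of the kernel is congruent, modulo the relations, to a reduced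
    element of the kernel, which is 0 since [B] is a basis. *)
Lemma PBW_presents : presents X g.
Proof.
apply/presentsP; split.
  by move=> x; have [c [[_ cE] _]] := basis x; exists c.
move=> a; split=> [a0|]; last first.
  apply: extension_ideal => r [al ->]; rewrite raddfB /= PBW_cells_extension.
  exact: subrr.
have [b ab redb] := reduced_form (X := X) mo PBW_compatible a.
suff b0 : b = 0 by have := rewrites_ideal ab; rewrite b0 subr0.
apply: (linear_basis_inj basis).
- by rewrite -PBW_reduced_monomials; apply: (reducedE (X := X) b).1.
- by move=> k; rewrite msupp0.
- by rewrite -(rewrites_extension PBW_cells_extension ab) a0 raddf0.
Qed.

(** Rewriting preserves the image in the algebra, so the reduced forms of two
    reducts of [a] have the same image and are supported on [B]. *)
Lemma PBW_confluent : confluent X.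
Proof.
move=> a b c ab ac.
have [b' bb' redb] := reduced_form (X := X) mo PBW_compatible b.
have [c' cc' redc] := reduced_form (X := X) mo PBW_compatible c.
have ext := rewrites_extension PBW_cells_extension.
have b'c' : b' = c'.
  apply: (linear_basis_inj basis).
  - by rewrite -PBW_reduced_monomials; apply: (reducedE (X := X) b').1.
  - by rewrite -PBW_reduced_monomials; apply: (reducedE (X := X) c').1.
  - by rewrite -(ext _ _ bb') -(ext _ _ cc') -(ext _ _ ab) -(ext _ _ ac).
by exists b'; split; rewrite // b'c'.
Qed.

End PolygraphOfPBW.

Theorem proposition3p5p4 (K : fieldType) (N : nat) (A : algType K) :
  (2 <= N)%N ->
  (forall (X : polygraph K) (g : cells0 X -> A) (le : rel {fmonom (cells0 X)}),
     presents X g -> homogeneous_polygraph X N -> left_monomial X ->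
     convergent X ->
     monomial_order le -> compatible X le ->
     degree1_generating_set (degree_part g) g /\
     PBW_basis g N le (reduced_monomials X)) /\
  (forall (deg : nat -> set A) (S : choiceType) (g : S -> A)
     (le : rel {fmonom S}) (B : set {fmonom S}),
     homogeneous_grading N deg -> degree1_generating_set deg g ->
     monomial_order le -> PBW_basis g N le B ->
     [/\ presents (PBW_polygraph g N B) g,
         homogeneous_polygraph (PBW_polygraph g N B) N,
         left_monomial (PBW_polygraph g N B),
         convergent (PBW_polygraph g N B)
       & reduced_monomials (PBW_polygraph g N B) = B /\
         compatible (PBW_polygraph g N B) le]).
Proof.
move=> N2; split.
  move=> X g le presX homX _ [_ confl] mo compat; split.
    exact: (convergent_degree1 presX homX confl mo compat N2).
  exact: convergent_PBW_basis.
move=> deg S g le B grad [_ deg1 _] mo pbw.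
have compat := PBW_compatible pbw.
split.
- exact: (PBW_presents N2 mo pbw).
- exact: (PBW_homogeneous pbw grad deg1).
- exact: (compatible_left_monomial compat).
- split.
    exact: (@compatible_terminates K (PBW_polygraph g N B) le mo compat).
  exact: (PBW_confluent N2 mo pbw).
- by split=> //; apply: (PBW_reduced_monomials N2 pbw).
Qed.
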